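(* Let $R$ be a (not necessarily commutative) ring, $M$ a nonzero right $R$-module and $S=\mathrm{End}_R(M)$. The following statements are equivalent: (1) $M$ is a morphic $R$-module and $S$ is a reduced ring; (2) $M$ is an Abelian endoregular $R$-module.
   Context: Rings are associative and unital; modules are unitary. - $M$ is morphic if $M/\varphi(M)\cong\ker(\varphi)$ as $R$-modules for every $\varphi\in \mathrm{End}_R(M)$. - A ring is reduced if it has no nonzero nilpotent elements. - A ring $T$ is strongly regular if for each $a\in T$ there is $y\in T$ with $a=a^2y$. - $M$ is Abelian endoregular if $\mathrm{End}_R(M)$ is a strongly regular ring. *)

(* Defs.v *)
From HB Require Import structures.
From mathcomp Require Import all_boot ssralg ring_quotient.
From mathcomp Require Import boolp.

Set Implicit Arguments.
Unset Strict Implicit.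
Unset Printing Implicit Defensive.

Import GRing.Theory.
Local Open Scope ring_scope.
Local Open Scope quotient_scope.

(* MathComp's [lmodType R] is the type of left R-modules; a right module over *)
(* R is an [lmodType R^c], where R^c is the converse ring: for a, b : R^c the *)
(* axiom a *: (b *: m) = (a * b) *: m then reads (m b) a = m (b a) in R.  The *)
(* definitions below are stated for [lmodType R] and used at R^c.             *)

Definition reduced (T : pzRingType) : Prop :=
  forall (a : T) (n : nat), a ^+ n = 0 -> a = 0.

Definition strongly_regular (T : pzRingType) : Prop :=
  forall a : T, exists y : T, a = a ^+ 2 * y.

Definition isomorphic (R : pzRingType) (U V : lmodType R) : Prop :=
  exists f : {linear U -> V}, bijective f.

(* The product is composition, (f * g) x = f (g x), i.e., endomorphisms are   *)
(* written on the left.                                                       *)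
Section Endomorphisms.
Variables (R : pzRingType) (M : lmodType R).

Definition endo : Type := {linear M -> M}.

HB.instance Definition _ := gen_eqMixin endo.
HB.instance Definition _ := gen_choiceMixin endo.

Lemma endoP (f g : endo) : f =1 g -> f = g.
Proof.
case: f g => [f cf] [g cg] /funext /= efg.
move: cf cg; rewrite /= in efg *; rewrite efg => -[[a] [b]] [[a'] [b']].
by rewrite (Prop_irrelevance a a') (Prop_irrelevance b b').
Qed.

Definition endo0 : endo := (\0 : M -> M) : {linear M -> M}.
Definition endo_add (f g : endo) : endo := (f \+ g) : {linear M -> M}.
Definition endo_opp (f : endo) : endo := (\- f) : {linear M -> M}.
Definition endo1 : endo := (idfun : M -> M) : {linear M -> M}.
Definition endo_mul (f g : endo) : endo := (f \o g) : {linear M -> M}.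

Fact endo_addA : associative endo_add.
Proof. by move=> f g h; apply: endoP => x /=; rewrite addrA. Qed.
Fact endo_addC : commutative endo_add.
Proof. by move=> f g; apply: endoP => x /=; rewrite addrC. Qed.
Fact endo_add0 : left_id endo0 endo_add.
Proof. by move=> f; apply: endoP => x /=; rewrite add0r. Qed.
Fact endo_addN : left_inverse endo0 endo_opp endo_add.
Proof. by move=> f; apply: endoP => x /=; rewrite addNr. Qed.

HB.instance Definition _ :=
  GRing.isZmodule.Build endo endo_addA endo_addC endo_add0 endo_addN.

Fact endo_mulA : associative endo_mul.
Proof. by move=> f g h; apply: endoP. Qed.
Fact endo_mul1 : left_id endo1 endo_mul.
Proof. by move=> f; apply: endoP. Qed.
Fact endo_mulr1 : right_id endo1 endo_mul.
Proof. by move=> f; apply: endoP. Qed.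
Fact endo_mulDl : left_distributive endo_mul +%R.
Proof. by move=> f g h; apply: endoP. Qed.
Fact endo_mulDr : right_distributive endo_mul +%R.
Proof. by move=> f g h; apply: endoP => x /=; rewrite raddfD. Qed.

HB.instance Definition _ := GRing.Zmodule_isPzRing.Build endo
  endo_mulA endo_mul1 endo_mulr1 endo_mulDl endo_mulDr.

End Endomorphisms.

Section KernelCokernel.
Variables (R : pzRingType) (M : lmodType R) (phi : {linear M -> M}).

Definition in_ker : pred M := fun x => phi x == 0.

Fact in_ker_closed : subsemimod_closed in_ker.
Proof.
split; first split; rewrite ?unfold_in /in_ker ?raddf0 //.
  move=> x y; rewrite !unfold_in /in_ker linearD => /eqP -> /eqP ->.
  by rewrite addr0.
by move=> a x; rewrite !unfold_in /in_ker linearZ_LR => /eqP ->; rewrite scaler0.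
Qed.

HB.instance Definition _ := GRing.isSubmodClosed.Build R M in_ker in_ker_closed.

Definition ker : Type := {x : M | in_ker x}.

HB.instance Definition _ := SubChoice.on ker.
HB.instance Definition _ := [SubChoice_isSubLmodule of ker by <:].

Definition in_im : pred M := fun y => `[< exists x : M, phi x = y >].

Fact in_im_closed : subsemimod_closed in_im.
Proof.
split; first split.
- by apply/asboolP; exists 0; rewrite raddf0.
- move=> _ _ /asboolP[x <-] /asboolP[y <-]; apply/asboolP.
  by exists (x + y); rewrite raddfD.
by move=> a _ /asboolP[x <-]; apply/asboolP; exists (a *: x); rewrite linearZ.
Qed.

HB.instance Definition _ := GRing.isSubmodClosed.Build R M in_im in_im_closed.

Definition im : zmodClosed M := GRing.ZmodClosed.clone M in_im _.

(* The quotient module M / phi(M): the library provides the quotient group,   *)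
(* to which the scaling a *: \pi x = \pi (a *: x) is added.                   *)
Definition coker : Type := {ideal_quot im}.

HB.instance Definition _ := EqQuotient.on coker.
HB.instance Definition _ := GRing.Zmodule.on coker.

Definition coker_scale (a : R) (u : coker) : coker := \pi_coker (a *: repr u).

Fact coker_piZ a (x : M) :
  coker_scale a (\pi_coker x) = \pi_coker (a *: x).
Proof.
apply/eqP; rewrite /coker_scale -[_ == _]Quotient.idealrBE -scalerBr.
by rewrite rpredZ // Quotient.idealrBE reprK.
Qed.

Fact coker_piD (x y : M) : \pi_coker x + \pi_coker y = \pi_coker (x + y).
Proof. exact: (esym (raddfD (\pi_{ideal_quot im}) x y)). Qed.

Fact coker_scaleA a b u :
  coker_scale a (coker_scale b u) = coker_scale (a * b) u.
Proof. by rewrite -[u]reprK (coker_piZ b) !coker_piZ scalerA. Qed.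
Fact coker_scale1 : left_id 1 coker_scale.
Proof. by move=> u; rewrite -[u]reprK coker_piZ scale1r. Qed.
Fact coker_scaleDr : right_distributive coker_scale +%R.
Proof.
by move=> a u v; rewrite -[u]reprK -[v]reprK coker_piD !coker_piZ coker_piD scalerDr.
Qed.
Fact coker_scaleDl u : {morph coker_scale^~ u : a b / a + b}.
Proof. by move=> a b; rewrite -[u]reprK !coker_piZ coker_piD scalerDl. Qed.

HB.instance Definition _ := GRing.Zmodule_isLmodule.Build R coker
  coker_scaleA coker_scale1 coker_scaleDr coker_scaleDl.

End KernelCokernel.

Definition morphic (R : pzRingType) (M : lmodType R) : Prop :=
  forall phi : endo M, isomorphic (coker phi) (ker phi).

Definition abelian_endoregular (R : pzRingType) (M : lmodType R) : Prop :=
  strongly_regular (endo M).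

(* Main.v *)
Require Import Defs.
From HB Require Import structures.
From mathcomp Require Import all_boot all_algebra.
From mathcomp Require Import boolp.
Local Open Scope ring_scope.

(** Everything is read off from the kernel and the image of an endomorphism
    phi of M.

    If M is morphic, composing M -> M/phi(M) ~ ker phi -> M yields psi with
    im psi = ker phi and ker psi = im phi ([morphic_dual]).  Thus inclusions
    between kernels or images of endomorphisms become equations between
    products in S.  In a reduced ring a^2 b = 0 forces a b = 0, and b a^2 = 0
    forces b a = 0; applied to the dual of phi^2, this gives
    ker phi^2 = ker phi and im phi^2 = im phi.  Hence phi is injective on im phi
    and maps it onto itself, and phi = phi^2 y, where y m is the unique z in
    im phi with phi^2 z = phi m ([strongly_regular_of_ker_im]).

    Conversely, iterating a = a^2 y gives a = a^(n+1) y^n, so S is reduced; in a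
    reduced ring such a y commutes with a.  For phi = phi^2 y the idempotent
    1 - phi y = 1 - y phi then has kernel im phi and image ker phi, so it
    induces an isomorphism M/phi(M) ~ ker phi ([morphic_of_strongly_regular]).
*)

Set Implicit Arguments.
Unset Strict Implicit.
Unset Printing Implicit Defensive.

Import GRing.Theory.
Local Open Scope quotient_scope.

Section Rings.
Variable T : pzRingType.
Implicit Types a b y : T.

Lemma reduced_sqr0 a : reduced T -> a * a = 0 -> a = 0.
Proof. by move=> redT aa0; apply: (redT a 2); rewrite expr2. Qed.

Lemma reduced_mul0C a b : reduced T -> a * b = 0 -> b * a = 0.
Proof.
move=> redT ab0; apply: reduced_sqr0 => //.
by rewrite mulrA -(mulrA b) ab0 mulr0 mul0r.
Qed.

Lemma reduced_sqr_mul0l a b : reduced T -> a * (a * b) = 0 -> a * b = 0.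
Proof.
move=> redT /(reduced_mul0C redT) aba0; apply: reduced_sqr0 => //.
by rewrite mulrA aba0 mul0r.
Qed.

Lemma reduced_sqr_mul0r a b : reduced T -> (b * a) * a = 0 -> b * a = 0.
Proof.
move=> redT /(reduced_mul0C redT) aba0; apply: reduced_sqr0 => //.
by rewrite -mulrA aba0 mulr0.
Qed.

Lemma sqr_mul_expr a y n : a = a ^+ 2 * y -> a = a ^+ n.+1 * y ^+ n.
Proof.
move=> ay; elim: n => [|n IHn]; first by rewrite expr1 mulr1.
by rewrite {1}IHn exprSr {2}ay mulrA -exprD addn2 -mulrA -exprS.
Qed.

Lemma strongly_regular_reduced : strongly_regular T -> reduced T.
Proof.
move=> regT a n an0; have [y ay] := regT a.
by rewrite (sqr_mul_expr n ay) exprS an0 mulr0 mul0r.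
Qed.

(** Both a - a y a and a - y a a have square zero, so a = a y a = y a a, whence
    a y = (y a a) y = y (a a y) = y a. *)
Lemma reduced_sqr_mul_comm a y :
  reduced T -> a = a ^+ 2 * y -> a * y = y * a.
Proof.
move=> redT; rewrite expr2 => ay.
have aya : a = a * y * a.
  apply/eqP; rewrite -subr_eq0; apply/eqP/reduced_sqr0 => //.
  have aaya : a * (a * y * a) = a * a by rewrite !mulrA -ay.
  by rewrite mulrBl mulrBr -(mulrA (a * y)) mulrBr aaya !subrr mulr0 subrr.
have yaa : a = y * a * a.
  apply/eqP; rewrite -subr_eq0; apply/eqP/reduced_sqr0 => //.
  have ayaa : a * (y * a * a) = a * a by rewrite !mulrA -aya.
  by rewrite mulrBl mulrBr -(mulrA (y * a)) mulrBr ayaa !subrr mulr0 subrr.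
by rewrite {1}yaa -mulrA -mulrA (mulrA a a y) -ay.
Qed.

End Rings.

Section Modules.
Variables (R : pzRingType) (M : lmodType R).
Implicit Types phi psi : endo M.

Definition endo_of (f : M -> M) (lf : linear f) : endo M :=
  HB.pack_for {linear M -> M} f (GRing.isLinear.Build R M M *:%R f lf).

Lemma endo_ofE f (lf : linear f) x : endo_of lf x = f x.
Proof. by []. Qed.

Lemma endo_mulE phi psi x : (phi * psi) x = phi (psi x).
Proof. by []. Qed.

Lemma endo_mul0P phi psi : phi * psi = 0 <-> forall x, phi (psi x) = 0.
Proof.
split=> [pp0 x|pp0]; first by rewrite -endo_mulE pp0.
exact: endoP.
Qed.

Lemma eq_coker phi x y :
  \pi_(coker phi) x = \pi_(coker phi) y <-> exists z, phi z = x - y.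
Proof.
have piE : (x - y \in im phi) = (\pi_(coker phi) x == \pi_(coker phi) y).
  exact: Quotient.idealrBE.
split=> [exy|imxy].
  by apply/asboolP; move/eqP: exy; rewrite -piE.
by apply/eqP; rewrite -piE; apply/asboolP.
Qed.

Lemma coker_pi_linear phi : linear (fun x => \pi_(coker phi) x).
Proof. by move=> a x y; rewrite -coker_piD -coker_piZ. Qed.

(** The composite M -> M/phi(M) ~ ker phi -> M turns membership in the kernel
    and in the image of phi into equations between endomorphisms. *)
Lemma morphic_dual phi : morphic M -> exists psi : endo M,
  (forall x, phi x = 0 <-> exists z, psi z = x) /\
  (forall x, psi x = 0 <-> exists z, phi z = x).
Proof.
move=> /(_ phi)[h [g hK gK]].
have lpsi : linear (fun x => \val (h (\pi_(coker phi) x))).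
  by move=> a x y; rewrite coker_pi_linear !linearP.
have pi0 : \pi_(coker phi) 0 = 0 by rewrite raddf0.
exists (endo_of lpsi); split=> x; split.
- move=> /eqP phix0; pose u : ker phi := Sub x phix0.
  by exists (repr (g u)); rewrite endo_ofE reprK gK SubK.
- by case=> z <-; apply/eqP; apply: (valP (h (\pi_(coker phi) z))).
- rewrite endo_ofE => hx0.
  have : h (\pi_(coker phi) x) = h (\pi_(coker phi) 0).
    by apply: val_inj; rewrite hx0 pi0 !linear0.
  by move/(can_inj hK)/eq_coker; rewrite subr0.
- case=> z phiz; rewrite endo_ofE.
  have -> : \pi_(coker phi) x = \pi_(coker phi) 0.
    by apply/eq_coker; exists z; rewrite subr0.
  by rewrite pi0 !linear0.
Qed.

Lemma morphic_reduced_ker_sqr phi x :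
  morphic M -> reduced (endo M) -> phi (phi x) = 0 -> phi x = 0.
Proof.
move=> morM redS phi2x; have [psi [kerE _]] := morphic_dual (phi * phi) morM.
have [z <-] := (kerE x).1 phi2x.
move: z; apply/endo_mul0P/reduced_sqr_mul0l => //.
by rewrite mulrA; apply/endo_mul0P => z; apply/kerE; exists z.
Qed.

Lemma morphic_reduced_im_sqr phi x :
  morphic M -> reduced (endo M) -> exists z, phi (phi z) = phi x.
Proof.
move=> morM redS; have [psi [_ kerE]] := morphic_dual (phi * phi) morM.
apply: (kerE _).1; move: x; apply/endo_mul0P/reduced_sqr_mul0r => //.
by rewrite -mulrA; apply/endo_mul0P => z; apply/kerE; exists z.
Qed.

(** The hypotheses make phi bijective on its image, so that each m has a
    unique z in the image with phi (phi z) = phi m; uniqueness makes z linear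
    in m. *)
Lemma strongly_regular_of_ker_im phi :
  (forall x, phi (phi x) = 0 -> phi x = 0) ->
  (forall x, exists z, phi (phi z) = phi x) ->
  exists y : endo M, phi = phi ^+ 2 * y.
Proof.
move=> ker2 im2.
(* w is a preimage of z under phi: this places z in the image. *)
have ex_w m : exists w, phi (phi (phi w)) = phi m.
  by have [z <-] := im2 m; have [w <-] := im2 z; exists w.
have [w wP] := choice ex_w.
have lin_y : linear (fun m => phi (w m)).
  move=> a m n /=; apply/eqP; rewrite -subr_eq0 -linearP -linearB; apply/eqP.
  have wlin : phi (phi (phi (a *: w m + w n))) = phi (a *: m + n).
    by rewrite !linearP !wP.
  by do 2!apply: (ker2 _); rewrite !linearB wP wlin subrr.
exists (endo_of lin_y); apply: endoP => m.
by rewrite expr2 !endo_mulE endo_ofE wP.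
Qed.

(** The endomorphism 1 - phi y kills im phi, fixes ker phi pointwise because
    phi y = y phi, and takes its values in ker phi. *)
Lemma morphic_of_strongly_regular : strongly_regular (endo M) -> morphic M.
Proof.
move=> regS phi; have [y phiy] := regS phi.
have comm := reduced_sqr_mul_comm (strongly_regular_reduced regS) phiy.
have commE x : phi (y x) = y (phi x) by rewrite -!endo_mulE comm.
have regE x : phi (phi (y x)) = phi x by rewrite {3}phiy expr2 !endo_mulE.
pose p : endo M := 1 - phi * y.
have pE x : p x = x - phi (y x) by [].
have p_ker x : in_ker phi (p x).
  by rewrite /in_ker pE linearB regE subrr.
have p_im x : p (phi x) = 0 by rewrite pE -commE regE subrr.
pose f (u : coker phi) : ker phi := Sub (p (repr u)) (p_ker (repr u)).
have f_pi x : \val (f (\pi_(coker phi) x)) = p x.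
  rewrite SubK; apply/eqP; rewrite -subr_eq0 -linearB.
  have [|z <-] := (@eq_coker phi (repr (\pi_(coker phi) x)) x).1.
    by rewrite reprK.
  by rewrite p_im.
have lin_f : linear f.
  move=> a u v; apply: val_inj; rewrite -[u]reprK -[v]reprK -coker_pi_linear.
  by rewrite f_pi linearP -2!f_pi [RHS]linearP.
exists (HB.pack_for {linear coker phi -> ker phi} f
  (GRing.isLinear.Build R (coker phi) (ker phi) *:%R f lin_f)).
(* The inverse is the inclusion of ker phi followed by the projection. *)
exists (fun x => \pi_(coker phi) (\val x)) => [u|x] /=.
  rewrite -[u in RHS]reprK; apply/eq_coker; exists (- y (repr u)).
  by rewrite linearN addrAC subrr add0r.
apply: (@val_inj _ _ (ker phi)); rewrite [LHS]f_pi pE commE.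
by have /eqP -> := valP x; rewrite linear0 subr0.
Qed.

End Modules.

Theorem theorem2 (R : pzRingType) (M : lmodType R^c)
    (M_neq0 : exists x : M, x <> 0) :
  (morphic M /\ reduced (endo M)) <-> abelian_endoregular M.
Proof.
split=> [[morM redS] phi | regS].
  apply: strongly_regular_of_ker_im => x.
    exact: morphic_reduced_ker_sqr.
  exact: morphic_reduced_im_sqr.
split; first exact: morphic_of_strongly_regular.
exact: strongly_regular_reduced.
Qed.
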